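(* In the setting below, assume $f(\cdot,\xi)$ is convex for all $\xi\in\Xi$. Then for all $N\in\mathbb N$, $$\theta^2\,\mathbb E\big[\|u_N^*-u^*\|_{\mathcal U}^{2(\varrho-1)}\big]\le \frac1N\,C_{\mathcal H;\mathcal U^*}^2\,\sigma_{\mathrm Df}^2.$$
   Context: Let $U$ be a separable Hilbert space (identified with its dual, inner product $(\cdot,\cdot)_U$), $W$ a separable Banach space with dual $W^*$, and $B:U\to W$ a compact linear operator with adjoint $B^*$. Let $\psi:U\to[0,\infty]$ be proper, closed and convex with bounded domain $\mathcal D(\psi)=\{u:\psi(u)<\infty\}$. Let $U_0\subset U$ be open, convex and bounded with $\mathcal D(\psi)\subset U_0$. Let $\Xi$ be a complete separable metric space, $\boldsymbol\xi$ a $\Xi$-valued random element, and $\boldsymbol\xi^1,\boldsymbol\xi^2,\ldots$ i.i.d. copies of $\boldsymbol\xi$ on a complete probability space $(\Omega,\mathcal F,P)$. Let $f:B(U_0)\times\Xi\to\mathbb R$ be such that $f(\cdot,\xi)$ is continuous on $B(\mathcal D(\psi))$, $f(w,\cdot)$ is measurable, and $|f(Bu,\xi)|\le \zeta_f(\xi)$ on $U_0\times\Xi$ with $\zeta_f$ integrable. Assume: for each $\xi$, $g_\xi(u)=f(Bu,\xi)$ is continuously differentiable on $U_0$; there is a Carathéodory map $\mathrm D_wf:B(\mathcal D(\psi))\times\Xi\to W^*$ with $\nabla g_\xi(u)=B^*\mathrm D_wf(Bu,\xi)$ on $\mathcal D(\psi)\times\Xi$; there is an integrable $\zeta_{\mathrm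 Df}$ with $\|\nabla g_\xi(u)\|_U\le\zeta_{\mathrm Df}(\xi)$ on $U_0\times\Xi$ and $\|\mathrm D_wf(Bu,\xi)\|_{W^*}\le\zeta_{\mathrm Df}(\xi)$ on $\mathcal D(\psi)\times\Xi$. Let $F(w)=\mathbb E[f(w,\boldsymbol\xi)]$, $\mathrm DF(w)=\mathbb E[\mathrm D_wf(w,\boldsymbol\xi)]$, $G(u)=F(Bu)+\psi(u)$, $\hat F_N(w)=\frac1N\sum_{i=1}^Nf(w,\boldsymbol\xi^i)$. Let $u^*$ be a solution of $\min_{u\in U}G(u)$ and for each $N$ let $u_N^*:\Omega\to U$ be measurable with $u_N^*(\omega)$ a solution of $\min_{u\in U}\hat F_N(Bu,\omega)+\psi(u)$. Further assume: $\mathcal U$ is a Banach space with $\mathcal U^*\hookrightarrow U\hookrightarrow\mathcal U$, $\mathcal H$ is a separable Hilbert space with $\mathcal H\hookrightarrow\mathcal U^*$ (embedding constant $C_{\mathcal H;\mathcal U^*}$), and $|(v,u)_U|\le\|v\|_{\mathcal U^*}\|u\|_{\mathcal U}$ for all $v\in\mathcal U^*$, $u\in U$; there are $\theta\in(0,\infty)$, $\varrho\in[2,\infty)$ with $(B^*\mathrm DF(Bu^* ),u-u^* )_U+\psi(u)-\psi(u^* )\ge\theta\|u-u^*\|_{\mathcal U}^{\varrho}$ for all $u\in U$; the map $\xi\mapsto\nabla g_\xi(u^* )\in\mathcal H$ is integrable and $\sigma_{\mathrm Df}=(\mathbb E[\|\nabla g_{\boldsymbol\xi}(u^* )-\mathbb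 E[\nabla g_{\boldsymbol\xi}(u^* )]\|_{\mathcal H}^2])^{1/2}<\infty$. *)

(* Defs.v *)
From mathcomp Require Import all_boot all_order all_algebra.
From mathcomp Require Import all_classical all_reals all_analysis.
Import numFieldNormedType.Exports.
Import Order.TTheory GRing.Theory Num.Theory.

Set Implicit Arguments.
Unset Strict Implicit.
Unset Printing Implicit Defensive.

Local Open Scope classical_set_scope.
Local Open Scope ring_scope.

Section Defs.
Variable R : realType.

Definition is_dual (V : normedModType R) (phi : V -> R) : Prop :=
  (forall (a : R) (x y : V), phi (a *: x + y) = a * phi x + phi y) /\
  continuous phi.

Definition dual_norm (V : normedModType R) (phi : V -> R) : R :=
  sup [set `|phi v| | v in [set v : V | `|v| <= 1]].

Definition dual_open (V : normedModType R) (O : set (V -> R)) : Prop :=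
  forall phi, O phi -> exists2 e : R, 0 < e &
    forall psi, is_dual psi -> dual_norm (fun v => psi v - phi v) < e -> O psi.

Definition dual_measurable (d : measure_display) (T : measurableType d)
  (V : normedModType R) (h : T -> (V -> R)) : Prop :=
  forall O : set (V -> R), dual_open O -> measurable (h @^-1` O).

Definition borel_measurable (d : measure_display) (T : measurableType d)
  (V : topologicalType) (h : T -> V) : Prop :=
  forall O : set V, open O -> measurable (h @^-1` O).

(** [ip] is an inner product inducing the norm of [V] (so [V], being complete,
    is a real Hilbert space). *)
Definition is_inner_product (V : normedModType R) (ip : V -> V -> R) : Prop :=
  (forall (a : R) (x y z : V), ip (a *: x + y) z = a * ip x z + ip y z) /\
  (forall x y : V, ip x y = ip y x) /\
  (forall x : V, ip x x = `|x| ^+ 2).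

Definition separable_space (V : topologicalType) : Prop :=
  exists D : set V, countable D /\ closure D = setT.

Definition polish_borel (d : measure_display) (T : measurableType d) : Prop :=
  exists dist : T -> T -> R,
    (forall x y, 0 <= dist x y /\ (dist x y = 0 <-> x = y)) /\
        (forall x y, dist x y = dist y x) /\
        (forall x y z, dist x z <= dist x y + dist y z) /\
        (forall s : nat -> T,
           (forall e : R, 0 < e -> exists n0 : nat, forall m n : nat,
              (n0 <= m)%N -> (n0 <= n)%N -> dist (s m) (s n) < e) ->
           exists l : T, forall e : R, 0 < e -> exists n0 : nat,
              forall n : nat, (n0 <= n)%N -> dist (s n) l < e) /\
        (exists D : set T, countable D /\
           forall x (e : R), 0 < e -> exists2 y, D y & dist x y < e) /\
        (@measurable d T = <<s [set A : set T | forall x, A x ->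
            exists2 e : R, 0 < e & forall y, dist x y < e -> A y] >>).

Definition mutually_independent (d : measure_display) (Omega : measurableType d)
  (dX : measure_display) (X : measurableType dX)
  (P : probability Omega R) (xs : nat -> Omega -> X) : Prop :=
  forall (s : seq nat) (A : nat -> set X), uniq s ->
    (forall i, measurable (A i)) ->
    P (\bigcap_(i in [set` s]) (xs i @^-1` A i)) =
    (\prod_(i <- s) P (xs i @^-1` A i))%E.

Definition Fexp (d : measure_display) (Omega : measurableType d)
  (P : probability Omega R) (dX : measure_display) (X : measurableType dX)
  (W : Type) (xi : Omega -> X) (f : W -> X -> R) (w : W) : R :=
  fine (\int[P]_om (f w (xi om))%:E)%E.

(** DF(w) = E[D_w f(w, xi)] as an element of W^* (evaluated pointwise). *)
Definition DFexp (d : measure_display) (Omega : measurableType d)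
  (P : probability Omega R) (dX : measure_display) (X : measurableType dX)
  (W : Type) (xi : Omega -> X) (Df : W -> X -> W -> R) (w : W) : W -> R :=
  fun v => fine (\int[P]_om (Df w (xi om) v)%:E)%E.

Definition FhatN (d : measure_display) (Omega : measurableType d)
  (dX : measure_display) (X : measurableType dX) (W : Type)
  (xis : nat -> Omega -> X) (f : W -> X -> R) (N : nat) (w : W) (om : Omega) : R :=
  N%:R^-1 * \sum_(i < N) f w (xis i om).

End Defs.

(* Main.v *)
Require Import Defs.
From HB Require Import structures.
From mathcomp Require Import all_boot all_order all_algebra.
From mathcomp Require Import all_classical all_reals all_analysis.
From mathcomp Require Import measurable_realfun ring lra.
Import numFieldNormedType.Exports.
Import Order.TTheory GRing.Theory Num.Theory.
Local Open Scope classical_set_scope.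
Local Open Scope ring_scope.

(** Write [h = uN - ustar], [r = |jU h|] and let [M] be the sample mean of the
    gradients [gradH] at [ustar]. Convexity bounds the increment of the sampled
    objective from below by its derivative at [ustar]; with the optimality of
    [uN] and the growth condition at [uN] this gives
    [theta r^rho <= (meanH - M, h) <= C_H |M - meanH| r], where [H] is paired
    with [U] through its embedding. Dividing by [r] and squaring reduces the
    theorem to the variance of a sample mean, [E |M - meanH|^2 = sigma^2 / N]:
    the cross terms are inner products of independent centered variables, which
    vanish by Fubini. The expectation [meanH] is only given weakly, so Riesz'
    theorem in [H] is needed to see that every continuous functional on [H], in
    particular the pairing with [h], commutes with it. *)

Definition pack_scalar {R : pzRingType} {V : lmodType R} {l : V -> R}
  (l_scalar : scalar l) : {scalar V} :=
  HB.pack l (GRing.isLinear.Build R V R *%R l l_scalar).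

Section dual.
Context {R : realType} {V : normedModType R}.
Implicit Types (phi psi : V -> R) (v : V).

Lemma bounded_is_dual {phi} (C : R) :
  scalar phi -> (forall v, `|phi v| <= C * `|v|) -> is_dual phi.
Proof.
move=> phi_scalar phi_le; split=> //.
pose f : {linear V -> R^o} := pack_scalar phi_scalar.
suff : bounded_near f (nbhs 0) by exact: bounded_linear_continuous.
apply/linear_boundedP; near=> r => v; apply: le_trans (phi_le v) _.
by rewrite ler_wpM2r//; near: r; exact: nbhs_pinfty_ge.
Unshelve. all: by end_near. Qed.

Lemma is_dual_bounded {phi} :
  is_dual phi -> exists2 C : R, 0 < C & forall v, `|phi v| <= C * `|v|.
Proof.
move=> [phi_scalar phi_cont]; apply: pinfty_ex_gt0.
pose f : {linear V -> R^o} := pack_scalar phi_scalar.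
suff : bounded_near f (nbhs 0) by move/linear_boundedP.
exact/linear_bounded_continuous.
Qed.

Lemma is_dualB {phi psi} :
  is_dual phi -> is_dual psi -> is_dual (fun v => phi v - psi v).
Proof.
move=> [phi_lin phi_cont] [psi_lin psi_cont]; split=> [a x y|x].
  by rewrite phi_lin psi_lin; ring.
by apply: cvgB; [exact: phi_cont|exact: psi_cont].
Qed.

Lemma ler_dual_norm {phi} v : is_dual phi -> `|phi v| <= dual_norm phi * `|v|.
Proof.
move=> dphi; have [phi_scalar _] := dphi.
have [C C0 phi_le] := is_dual_bounded dphi.
have phi0 : phi 0 = 0 := linear0 (pack_scalar phi_scalar).
have phiZ a x : phi (a *: x) = a * phi x.
  exact: (scalarZ (pack_scalar phi_scalar)).
have [->|v0] := eqVneq v 0; first by rewrite phi0 !normr0 mulr0.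
rewrite -ler_pdivrMr ?normr_gt0//; apply: ub_le_sup.
  exists C => _ [x /= x1 <-]; apply: le_trans (phi_le x) _.
  by rewrite ler_piMr// ltW.
exists (`|v|^-1 *: v) => /=.
  by rewrite normrZ normfV normr_id mulVf// normr_eq0.
by rewrite phiZ normrM normfV normr_id mulrC.
Qed.

(* The restriction to dual elements matters: [dual_norm] of an unbounded
   function is the junk value [sup = 0], so [c < phi v] alone would not be
   [dual_open]. *)
Lemma dual_open_gt v (c : R) : dual_open [set phi | is_dual phi /\ c < phi v].
Proof.
move=> phi [dphi c_phi].
have nv : 0 < `|v| + 1 by rewrite ltr_wpDl.
exists ((phi v - c) / (`|v| + 1)); first by rewrite divr_gt0// subr_gt0.
move=> psi dpsi; rewrite ltr_pdivlMr// => psi_near; split=> //.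
have := ler_dual_norm v (is_dualB dpsi dphi).
rewrite distrC; have := ler_norm (phi v - psi v).
have [n0|n0] := leP 0 (dual_norm (fun v => psi v - phi v)); first by lra.
by have := mulr_le0_ge0 (ltW n0) (normr_ge0 v); lra.
Qed.

Lemma dual_measurable_apply {d} {T : measurableType d} {h : T -> V -> R} v :
  (forall x, is_dual (h x)) -> dual_measurable h ->
  measurable_fun setT (fun x => h x v).
Proof.
move=> h_dual h_meas; apply: (measurability _ (RGenOInfty.measurableE R)).
move=> _ [_ [c ->] <-]; rewrite setTI.
rewrite (_ : _ @^-1` _ = h @^-1` [set phi | is_dual phi /\ c < phi v]).
  exact/h_meas/dual_open_gt.
by apply/seteqP; split=> [x|x []] /=; rewrite in_itv/= andbT.
Qed.

Lemma is_dual_Rintegral {d} {T : measurableType d}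
    {mu : {measure set T -> \bar R}} (h : T -> V -> R) (z : T -> R) :
  (forall x, is_dual (h x)) -> (forall v, measurable_fun setT (h^~ v)) ->
  (forall x, dual_norm (h x) <= z x) -> mu.-integrable setT (EFin \o z) ->
  is_dual (fun v => \int[mu]_x h x v).
Proof.
move=> h_dual mh h_le iz.
have hv_le v x : `|h x v| <= `|v| * z x.
  by apply: le_trans (ler_dual_norm v (h_dual x)) _; rewrite mulrC ler_wpM2l.
have ivz v : mu.-integrable setT (EFin \o (fun x => `|v| * z x)).
  exact: (integrableZl measurableT `|v| iz).
have ih v : mu.-integrable setT (EFin \o h^~ v).
  apply: le_integrable (ivz v) => //; first exact/measurable_EFinP.
  by move=> x _; rewrite lee_fin (le_trans (hv_le v x))// ler_norm.
apply: (bounded_is_dual (\int[mu]_x z x)) => [a v w|v].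
  have iahv : mu.-integrable setT (EFin \o (fun x => a * h x v)).
    exact: (integrableZl measurableT a (ih v)).
  rewrite -RintegralZl// -RintegralD//.
  by apply: eq_Rintegral => x _; have [-> _] := h_dual x.
apply: le_trans (le_normr_Rintegral measurableT (ih v)) _.
rewrite mulrC -RintegralZl//; apply: le_Rintegral => //.
exact: (integrable_norm (ih v)).
Qed.

End dual.

Lemma is_dual_DFexp {R : realType} {d d'} {Omega : measurableType d}
    {Xi : measurableType d'} {P : probability Omega R} {W : normedModType R}
    {xi : Omega -> Xi} {Df : W -> Xi -> W -> R} {zeta : Xi -> R} {w : W} :
  measurable_fun setT xi -> (forall x, is_dual (Df w x)) ->
  dual_measurable (Df w) -> (forall x, dual_norm (Df w x) <= zeta x) ->
  P.-integrable setT (EFin \o (zeta \o xi)) ->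
  is_dual (DFexp P xi Df w).
Proof.
move=> mxi Df_dual mDf Df_le izeta.
apply: (is_dual_Rintegral _ (zeta \o xi)) => // v.
exact: (measurableT_comp (dual_measurable_apply v Df_dual mDf) mxi).
Qed.

Lemma continuous_norm_sqr {R : realType} {V : normedModType R} :
  continuous (fun x : V => `|x| ^+ 2).
Proof. by move=> x; apply: cvgM; exact: cvg_norm. Qed.

Section inner_product.
Context {R : realType} {V : normedModType R} {ip : V -> V -> R}.
Hypothesis ipP : is_inner_product ip.
Implicit Types (x y z : V) (a : R).

Lemma ip_scalar z : scalar (ip^~ z).
Proof. by have [ip_lin _] := ipP => a x y; exact: ip_lin. Qed.

Let ipl z : {scalar V} := pack_scalar (ip_scalar z).

Lemma ipC x y : ip x y = ip y x.
Proof. by have [_ [+ _]] := ipP; apply. Qed.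

Lemma ip_norm x : ip x x = `|x| ^+ 2.
Proof. by have [_ [_]] := ipP; apply. Qed.

Lemma ip0l z : ip 0 z = 0.
Proof. exact: (linear0 (ipl z)). Qed.

Lemma ipDl x y z : ip (x + y) z = ip x z + ip y z.
Proof. exact: (linearD (ipl z)). Qed.

Lemma ipZl a x z : ip (a *: x) z = a * ip x z.
Proof. exact: (scalarZ (ipl z)). Qed.

Lemma ip_suml (I : Type) (s : seq I) (p : pred I) (F : I -> V) z :
  ip (\sum_(i <- s | p i) F i) z = \sum_(i <- s | p i) ip (F i) z.
Proof. exact: (linear_sum (ipl z)). Qed.

Lemma ipDr x y z : ip z (x + y) = ip z x + ip z y.
Proof. by rewrite !(ipC z) ipDl. Qed.

Lemma ipZr a x z : ip z (a *: x) = a * ip z x.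
Proof. by rewrite !(ipC z) ipZl. Qed.

Lemma ip_sumr (I : Type) (s : seq I) (p : pred I) (F : I -> V) z :
  ip z (\sum_(i <- s | p i) F i) = \sum_(i <- s | p i) ip z (F i).
Proof. by rewrite ipC ip_suml; apply: eq_bigr => i _; rewrite ipC. Qed.

Lemma normD_sqr x y : `|x + y| ^+ 2 = `|x| ^+ 2 + 2 * ip x y + `|y| ^+ 2.
Proof. by rewrite -ip_norm ipDl !ipDr !ip_norm (ipC y x); ring. Qed.

Lemma norm_sqr_sum (I : Type) (s : seq I) (F : I -> V) :
  `|\sum_(i <- s) F i| ^+ 2 = \sum_(i <- s) \sum_(j <- s) ip (F i) (F j).
Proof.
by rewrite -ip_norm ip_suml; apply: eq_bigr => i _; rewrite ip_sumr.
Qed.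

Lemma ip_polarization x y :
  ip x y = 2^-1 * (`|x + y| ^+ 2 - `|x| ^+ 2 - `|y| ^+ 2).
Proof. by rewrite normD_sqr; field. Qed.

Lemma parallelogram_law x y :
  `|x - y| ^+ 2 + `|x + y| ^+ 2 = 2 * (`|x| ^+ 2 + `|y| ^+ 2).
Proof.
by rewrite !normD_sqr -scaleN1r ipZr normrZ normrN1 mul1r; ring.
Qed.

Lemma ip_cauchy_schwarz x y : `|ip x y| <= `|x| * `|y|.
Proof.
have [->|y0] := eqVneq y 0; first by rewrite ipC ip0l normr0 mulr_ge0.
have y2 : 0 < `|y| ^+ 2 by rewrite exprn_gt0// normr_gt0.
have gram_ge0 : 0 <= `|y| ^+ 2 * ((`|x| * `|y|) ^+ 2 - ip x y ^+ 2).
  have := sqr_ge0 (`|(`|y| ^+ 2) *: x - ip x y *: y|).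
  rewrite -scaleNr normD_sqr ipZl ipZr !normrZ normrN !exprMn.
  by rewrite !real_normK ?num_real//; congr (_ <= _); ring.
rewrite -(@ler_pXn2r _ 2)// ?nnegrE ?mulr_ge0// real_normK ?num_real//.
by rewrite -subr_ge0 -(pmulr_rge0 _ y2).
Qed.

Lemma continuous_ip : continuous (fun p : V * V => ip p.1 p.2).
Proof.
have cvg_norm_sqr (g : V * V -> V) p :
    g @ p --> g p -> (fun q => `|g q| ^+ 2) @ p --> `|g p| ^+ 2.
  by move=> gp; exact: (cvg_comp _ _ gp (continuous_norm_sqr (g p))).
rewrite (_ : (fun _ => _) = fun p : V * V =>
    2^-1 * (`|p.1 + p.2| ^+ 2 - `|p.1| ^+ 2 - `|p.2| ^+ 2)); last first.
  by apply/funext => p; rewrite ip_polarization.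
move=> p; apply: cvgM; first exact: cvg_cst.
by apply: cvgB; [apply: cvgB|]; apply: cvg_norm_sqr;
  [apply: cvgD; [exact: cvg_fst|exact: cvg_snd]|exact: cvg_fst|exact: cvg_snd].
Qed.

Lemma quadratic_minimizer_ip (l : {scalar V}) (r : V) :
  (forall x, `|r| ^+ 2 - 2 * l r <= `|x| ^+ 2 - 2 * l x) ->
  forall x, l x = ip r x.
Proof.
move=> rmin x; apply/eqP; rewrite -subr_eq0; set a := l x - ip r x.
have n0 : 0 < `|x| ^+ 2 + 1 by rewrite ltr_wpDl// sqr_ge0.
pose s := (`|x| ^+ 2 + 1)^-1; have s0 : 0 < s by rewrite invr_gt0.
have s1 : s * `|x| ^+ 2 = 1 - s by rewrite /s; field; rewrite gt_eqF.
have := rmin (r + (s * a) *: x).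
rewrite linearD scalarZ normD_sqr ipZr normrZ exprMn real_normK ?num_real//.
have -> : (s * a) ^+ 2 * `|x| ^+ 2 = s * a ^+ 2 * (s * `|x| ^+ 2) by ring.
have -> : l x = a + ip r x by rewrite /a; ring.
rewrite s1 -subr_ge0 => increment_ge0.
have : 0 <= s * (1 + s) * - a ^+ 2 by move: increment_ge0; congr (_ <= _); ring.
rewrite pmulr_rge0 ?mulr_gt0 ?addr_gt0// oppr_ge0.
by rewrite real_exprn_even_le0 ?num_real.
Qed.

End inner_product.

Lemma strongly_midconvex_minimizer {R : realType} {V : completeNormedModType R}
    (J : V -> R) :
  continuous J -> has_lbound (range J) ->
  (forall x y, `|x - y| ^+ 2 <= 2 * (J x + J y) - 4 * J (2^-1 *: (x + y))) ->
  exists r, forall x, J r <= J x.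
Proof.
move=> J_cont J_lb J_mid.
have J_inf : has_inf (range J) by split=> //; exists (J 0), 0.
pose m := inf (range J).
have m_le x : m <= J x by apply: ge_inf => //; exists x.
have /choice[u u_min] n : exists x, J x < m + n.+1%:R^-1.
  have n0 : 0 < n.+1%:R^-1 :> R by rewrite invr_gt0.
  by have [_ [x _ <-] ?] := inf_adherent n0 J_inf; exists x.
have u_cvg : cvg (u @ \oo).
  apply/cauchy_cvgP/cauchy_ballP => e e0; near_simpl.
  have e4 : 0 < e ^+ 2 / 4 by rewrite divr_gt0// exprn_gt0.
  near=> x => /=; rewrite -ball_normE /=.
  rewrite -(@ltr_pXn2r _ 2)// ?nnegrE ?(ltW e0)//.
  apply: le_lt_trans (J_mid _ _) _.
  suff : J (u x.1) < m + e ^+ 2 / 4 /\ J (u x.2) < m + e ^+ 2 / 4.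
    by have := m_le (2^-1 *: (u x.1 + u x.2)); lra.
  split; apply: lt_trans (u_min _) _; rewrite ltrD2l.
  - by near: x; exact: (cvg_fst (near_infty_natSinv_lt (PosNum e4))).
  - by near: x; exact: (cvg_snd (near_infty_natSinv_lt (PosNum e4))).
exists (lim (u @ \oo)) => x; apply: le_trans (m_le x).
have Ju_cvg : J \o u @ \oo --> J (lim (u @ \oo)).
  by apply: continuous_cvg => //; exact: J_cont.
have m_cvg : (fun n => m + n.+1%:R^-1) @ \oo --> m + 0.
  by apply: cvgD; [exact: cvg_cst|exact: cvg_harmonic].
rewrite -[leRHS]addr0; apply: ler_cvg_to Ju_cvg m_cvg _.
by near=> n; apply/ltW/u_min.
Unshelve. all: by end_near. Qed.

(* The representative of [l] minimizes [|x|^2 - 2 l x]; the parallelogram law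
   makes this functional strongly midconvex. *)
Lemma riesz_representation {R : realType} {V : completeNormedModType R}
    {ip : V -> V -> R} {l : V -> R} :
  is_inner_product ip -> is_dual l -> exists r, forall x, l x = ip r x.
Proof.
move=> ipP l_dual; have [l_scalar l_cont] := l_dual.
have [C C0 l_le] := is_dual_bounded l_dual.
have lD x y : l (x + y) = l x + l y := linearD (pack_scalar l_scalar) x y.
have lZ a x : l (a *: x) = a * l x := scalarZ (pack_scalar l_scalar) a x.
have [|||r rmin] := strongly_midconvex_minimizer (fun x => `|x| ^+ 2 - 2 * l x).
- move=> x; apply: cvgB; first exact: continuous_norm_sqr.
  by apply: cvgM; [exact: cvg_cst|exact: l_cont].
- exists (- C ^+ 2) => _ [x _ <-]; have := le_trans (ler_norm _) (l_le x).
  by have := sqr_ge0 (`|x| - C); rewrite sqrrB; lra.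
- move=> x y; rewrite lZ lD normrZ ger0_norm ?invr_ge0// exprMn.
  by have := parallelogram_law ipP x y; lra.
by exists r; exact: (quadratic_minimizer_ip ipP (pack_scalar l_scalar)).
Qed.

Section borel.
Context {d : measure_display} {T : measurableType d}.

Lemma borel_measurable_cst {V : topologicalType} (v : V) :
  borel_measurable (fun _ : T => v).
Proof. by move=> O _; rewrite preimage_cst; case: ifP. Qed.

Lemma borel_measurable_comp {d'} {T' : measurableType d'} {V : topologicalType}
    {h : T -> V} {X : T' -> T} :
  borel_measurable h -> measurable_fun setT X -> borel_measurable (h \o X).
Proof.
by move=> mh mX O O_open; rewrite comp_preimage -[_ @^-1` _]setTI; apply/mX/mh.
Qed.

Lemma borel_measurable_continuous {V V' : topologicalType} {g : V -> V'}
    {h : T -> V} :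
  continuous g -> borel_measurable h -> borel_measurable (g \o h).
Proof.
move=> g_cont mh O O_open; rewrite comp_preimage; apply: mh.
by move/continuousP : g_cont; apply.
Qed.

Lemma borel_measurable_subr {R : realType} {V : normedModType R} (v : V)
    {h : T -> V} :
  borel_measurable h -> borel_measurable (fun x => h x - v).
Proof.
apply: (borel_measurable_continuous (g := fun w => w - v)) => w.
by apply: cvgB; [exact: cvg_id|exact: cvg_cst].
Qed.

Lemma borel_measurable_measurable_fun {R : realType} (h : T -> R) :
  borel_measurable h -> measurable_fun setT h.
Proof.
move=> mh; apply: (measurability _ (RGenOInfty.measurableE R)).
by move=> _ [_ [x ->] <-]; rewrite setTI; apply: mh; exact: interval_open.
Qed.

End borel.

Lemma separable_dense_sequence {R : realType} {V : pseudoPMetricType R} :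
  separable_space V ->
  exists v : nat -> V,
    forall (x : V) (e : R), 0 < e -> exists n, ball x e (v n).
Proof.
move=> [D [/pfcard_geP[->|[v]] D_dense]].
  have : closure (@set0 V) point by rewrite D_dense.
  by rewrite closure0.
exists v => x e e0; have : closure D x by rewrite D_dense.
move=> /(_ _ (nbhsx_ballx x e e0))[y [Dy xy]].
by have [n _ vn] := @surj _ _ _ _ v _ Dy; exists n; rewrite vn.
Qed.

(* Separability of [V] makes an open set of [V * V'] a countable union of open
   rectangles; otherwise it may fail to lie in the product sigma-algebra. *)
Lemma borel_measurable_continuous2 {R : realType} {d} {T : measurableType d}
    {V : pseudoPMetricType R} {V' V'' : topologicalType} {g : V * V' -> V''}
    {h : T -> V} {h' : T -> V'} :
  separable_space V -> continuous g ->
  borel_measurable h -> borel_measurable h' ->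
  borel_measurable (fun x => g (h x, h' x)).
Proof.
move=> /separable_dense_sequence[v v_dense] /continuousP g_cont mh mh' O.
move=> /g_cont gO.
pose e n : R := n.+1%:R^-1.
have e0 n : 0 < e n by rewrite invr_gt0.
pose A k n := (ball (v k) (e n))°.
pose B k n := [set w | forall u, ball (v k) (e n) u -> O (g (u, w))]°.
have -> : (fun x => g (h x, h' x)) @^-1` O =
    \bigcup_k \bigcup_n (h @^-1` A k n `&` h' @^-1` B k n).
  apply/seteqP; split=> [x Ox|x [k _] [n _] []]; last first.
    by move=> /interior_subset/= Ahx /interior_subset; apply.
  have [[P Q] [/nbhs_ballP[r /= r0 rP] hQ] PQ] := open_nbhs_nbhs (conj gO Ox).
  have r2 : 0 < r / 2 by rewrite divr_gt0.
  have [n en] : exists n, e n < r / 2.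
    have [n _ /(_ n (leqnn n)) en] := near_infty_natSinv_lt (PosNum r2).
    by exists n.
  have en2 : 0 < e n / 2 by rewrite divr_gt0.
  have [k xk] := v_dense (h x) (e n / 2) en2.
  exists k => //; exists n => //; split.
    apply/nbhs_ballP; exists (e n / 2) => // u xu.
    by rewrite (splitr (e n)); exact: ball_triangle (ball_sym xk) xu.
  apply: filterS hQ => w Qw u ku; apply: (PQ (u, w)); split=> //.
  apply: rP; rewrite (splitr r).
  apply: (ball_triangle (y := v k)).
    by apply: le_ball xk; lra.
  by apply: le_ball ku; exact: ltW.
apply: bigcupT_measurable => k; apply: bigcupT_measurable => n.
by apply: measurableI; [apply: mh|apply: mh']; exact: open_interior.
Qed.

Section borel_separable.
Context {R : realType} {d : measure_display} {T : measurableType d}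
  {V : normedModType R}.
Hypothesis sepV : separable_space V.

Lemma borel_measurable_sum (I : Type) (s : seq I) (h : I -> T -> V) :
  (forall i, borel_measurable (h i)) ->
  borel_measurable (fun x => \sum_(i <- s) h i x).
Proof.
move=> mh; elim: s => [|i s IHs].
  by under eq_fun do rewrite big_nil; exact: borel_measurable_cst.
under eq_fun do rewrite big_cons.
apply: (borel_measurable_continuous2 (g := fun p : V * V => p.1 + p.2)) => //.
by move=> p; apply: cvgD; [exact: cvg_fst|exact: cvg_snd].
Qed.

Lemma measurable_ip {ip : V -> V -> R} {h h' : T -> V} :
  is_inner_product ip -> borel_measurable h -> borel_measurable h' ->
  measurable_fun setT (fun x => ip (h x) (h' x)).
Proof.
move=> ipP mh mh'; apply: borel_measurable_measurable_fun.
exact: (borel_measurable_continuous2 sepV (continuous_ip ipP)).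
Qed.

End borel_separable.

Lemma measurable_norm_sqr {R : realType} {d} {T : measurableType d}
    {V : normedModType R} (h : T -> V) :
  borel_measurable h -> measurable_fun setT (fun x => `|h x| ^+ 2).
Proof.
move=> mh; apply: borel_measurable_measurable_fun.
exact: (borel_measurable_continuous continuous_norm_sqr mh).
Qed.

Lemma measurable_norm_comp_subr {R : realType} {d} {T : measurableType d}
    {V W : normedModType R} (j : V -> W) {h : T -> V} (v : V) :
  continuous j -> borel_measurable h ->
  measurable_fun setT (fun x => `|j (h x - v)|).
Proof.
move=> j_cont mh; apply: borel_measurable_measurable_fun.
apply: (borel_measurable_continuous _ (borel_measurable_subr v mh)
  (g := fun w => `|j w|)) => w.
exact: (cvg_norm (j_cont w)).
Qed.

Lemma Rintegral_sum {d} {T : measurableType d} {R : realType}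
    {mu : {measure set T -> \bar R}} {D : set T} (I : Type) (s : seq I)
    (f : I -> T -> R) :
  measurable D -> (forall i, mu.-integrable D (EFin \o f i)) ->
  \int[mu]_(x in D) (\sum_(i <- s) f i x) =
  \sum_(i <- s) \int[mu]_(x in D) f i x.
Proof.
move=> mD f_int; rewrite /Rintegral sum_fine => [|i _]; last first.
  exact: (integrable_fin_num mD (f_int i)).
by rewrite -integral_sum//; under eq_integral do rewrite -sumEFin.
Qed.

Definition same_law {R : realType} {d d'} {Omega : measurableType d}
    {T : measurableType d'} (P : probability Omega R) (X Y : Omega -> T) :
    Prop :=
  forall A, measurable A -> P (X @^-1` A) = P (Y @^-1` A).

Section law.
Context {R : realType} {d d' : measure_display} {Omega : measurableType d}
  {T : measurableType d'} {P : probability Omega R} {X Y : {mfun Omega >-> T}}.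
Hypothesis XY : same_law P X Y.
Local Open Scope ereal_scope.

Let ge0_integral_same_law (g : T -> \bar R) : measurable_fun setT g ->
  (forall x, 0 <= g x) -> \int[P]_om (g \o X) om = \int[P]_om (g \o Y) om.
Proof.
move=> mg g0; rewrite -!(ge0_integral_distribution _ mg)//.
by apply: eq_measure_integral => A mA _; exact: XY.
Qed.

Lemma integral_same_law {g : T -> \bar R} : measurable_fun setT g ->
  \int[P]_om (g \o X) om = \int[P]_om (g \o Y) om.
Proof.
move=> mg; rewrite integralE [RHS]integralE.
rewrite (funepos_comp g X) (funeneg_comp g X).
rewrite (funepos_comp g Y) (funeneg_comp g Y).
by rewrite !ge0_integral_same_law//;
  [exact: measurable_funeneg|exact: measurable_funepos].
Qed.

Lemma integrable_same_law {g : T -> \bar R} : measurable_fun setT g ->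
  P.-integrable setT (g \o Y) -> P.-integrable setT (g \o X).
Proof.
move=> mg /integrableP[_ gY]; apply/integrableP; split.
  exact: measurableT_comp.
by rewrite (integral_same_law (g := abse \o g))//; exact: measurableT_comp.
Qed.

End law.

Definition independent_pair {R : realType} {d d1 d2} {Omega : measurableType d}
    {T1 : measurableType d1} {T2 : measurableType d2} (P : probability Omega R)
    (X : Omega -> T1) (Y : Omega -> T2) : Prop :=
  forall A B, measurable A -> measurable B ->
    P (X @^-1` A `&` Y @^-1` B) = (P (X @^-1` A) * P (Y @^-1` B))%E.

Lemma integral_independent_pair {R : realType} {d d1 d2}
    {Omega : measurableType d} {T1 : measurableType d1} {T2 : measurableType d2}
    {P : probability Omega R} {X : {mfun Omega >-> T1}}
    {Y : {mfun Omega >-> T2}} {f : T1 * T2 -> \bar R} :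
  independent_pair P X Y -> measurable_fun setT f ->
  P.-integrable setT (fun om => f (X om, Y om)) ->
  (\int[P]_om f (X om, Y om) =
   \int[distribution P Y]_y \int[distribution P X]_x f (x, y))%E.
Proof.
move=> XY mf if_XY.
have mpair := measurable_fun_pair (measurable_funPT X) (measurable_funPT Y).
pose XYpair : {mfun Omega >-> (T1 * T2)%type} :=
  HB.pack (fun om => (X om, Y om)) (isMeasurableFun.Build _ _ _ _ _ mpair).
have lawE A : measurable A ->
    distribution P XYpair A = (distribution P X \x distribution P Y)%E A.
  by move=> mA; apply/esym; exact: product_measure_unique.
have f_int : (distribution P X \x distribution P Y)%E.-integrable setT f.
  apply/integrableP; split=> //.
  rewrite -(eq_measure_integral _ (fun A mA _ => lawE A mA)).
  by have /integrableP[] :=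
    integrable_pushforward (measurable_funPT XYpair) mf if_XY measurableT.
rewrite -[LHS](integral_distribution (X := XYpair) mf if_XY).
rewrite (eq_measure_integral _ (fun A mA _ => lawE A mA)).
by rewrite -integral21_prod_meas1.
Qed.

Lemma mutually_independent_pair {R : realType} {d d'} {Omega : measurableType d}
    {T : measurableType d'} {P : probability Omega R} {X : nat -> Omega -> T}
    {i j : nat} :
  mutually_independent P X -> i != j -> independent_pair P (X i) (X j).
Proof.
move=> X_indep ij A B mA mB.
have := X_indep [:: i; j] (fun k => if k == i then A else B).
rewrite /= inE ij => /(_ isT).
rewrite bigcap_seq !big_cons !big_nil setIT mule1 eqxx eq_sym (negbTE ij).
by apply=> k; case: ifP.
Qed.

Definition square_integrable {R : realType} {d} {Omega : measurableType d}
    (P : probability Omega R) {V : normedModType R} (X : Omega -> V) : Prop :=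
  borel_measurable X /\ P.-integrable setT (EFin \o (fun om => `|X om| ^+ 2)).

Section square_integrable.
Context {R : realType} {d : measure_display} {Omega : measurableType d}
  {P : probability Omega R} {V : normedModType R}.
Implicit Types (X Y : Omega -> V).

Lemma square_integrable_lty X : borel_measurable X ->
  (\int[P]_om (`|X om| ^+ 2)%:E < +oo)%E -> square_integrable P X.
Proof.
move=> mX X_lty; split=> //; apply/integrableP; split.
  exact/measurable_EFinP/measurable_norm_sqr.
by under eq_integral do rewrite gee0_abs ?lee_fin ?sqr_ge0//.
Qed.

Lemma square_integrable_cst (v : V) : square_integrable P (fun=> v).
Proof.
by split; [exact: borel_measurable_cst|exact: finite_measure_integrable_cst].
Qed.

Lemma square_integrableZ a X :
  square_integrable P X -> square_integrable P (fun om => a *: X om).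
Proof.
move=> [mX iX]; split.
  apply: (borel_measurable_continuous (g := fun v => a *: v)) mX => v.
  exact: scaler_continuous.
rewrite (_ : _ \o _ = fun om => (`|a| ^+ 2)%:E * (`|X om| ^+ 2)%:E)%E.
  exact: (integrableZl measurableT (`|a| ^+ 2) iX).
by apply/funext => om; rewrite /= normrZ exprMn EFinM.
Qed.

Lemma square_integrable_same_law {d'} {T : measurableType d'}
    {X Y : {mfun Omega >-> T}} {Z : T -> V} :
  same_law P X Y -> borel_measurable Z ->
  square_integrable P (Z \o Y) -> square_integrable P (Z \o X).
Proof.
move=> XY mZ [_ iY]; split; first exact: borel_measurable_comp.
have mZ2 : measurable_fun setT (EFin \o (fun x => `|Z x| ^+ 2)).
  exact/measurable_EFinP/measurable_norm_sqr.
exact: (integrable_same_law XY mZ2 iY).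
Qed.

Context {ip : V -> V -> R}.
Hypotheses (sepV : separable_space V) (ipP : is_inner_product ip).

Lemma integrable_ip {X Y} : square_integrable P X -> square_integrable P Y ->
  P.-integrable setT (EFin \o (fun om => ip (X om) (Y om))).
Proof.
move=> [mX iX] [mY iY].
apply: le_integrable (integrableD measurableT iX iY) => //.
  by apply/measurable_EFinP; exact: measurable_ip.
move=> om _ /=; rewrite lee_fin [leRHS]ger0_norm ?addr_ge0 ?sqr_ge0//.
apply: le_trans (ip_cauchy_schwarz ipP _ _) _.
have := sqr_ge0 (`|X om| - `|Y om|).
have := sqr_ge0 (`|X om|); have := sqr_ge0 (`|Y om|).
rewrite sqrrB; lra.
Qed.

Lemma square_integrable_sum {I : Type} (s : seq I) {X : I -> Omega -> V} :
  (forall i, square_integrable P (X i)) ->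
  square_integrable P (fun om => \sum_(i <- s) X i om).
Proof.
move=> X_sqr; split.
  by apply: borel_measurable_sum => // i; case: (X_sqr i).
rewrite (_ : _ \o _ = fun om =>
    \sum_(i <- s) \sum_(j <- s) (ip (X i om) (X j om))%:E)%E.
  apply: integrable_sum => // i _; apply: integrable_sum => // j _.
  exact: integrable_ip.
apply/funext => om; rewrite /= (norm_sqr_sum ipP) -sumEFin.
by apply: eq_bigr => i _; rewrite sumEFin.
Qed.

Lemma Rintegral_norm_sqr_sum_orthogonal {I : finType} {X : I -> Omega -> V} :
  (forall i, square_integrable P (X i)) ->
  (forall i j, i != j -> \int[P]_om ip (X i om) (X j om) = 0) ->
  \int[P]_om (`|\sum_i X i om| ^+ 2) = \sum_i \int[P]_om (`|X i om| ^+ 2).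
Proof.
move=> X_sqr X_orth.
transitivity (\int[P]_om \sum_i \sum_j ip (X i om) (X j om)).
  by apply: eq_Rintegral => om _; rewrite (norm_sqr_sum ipP).
rewrite Rintegral_sum// => [|i].
  apply: eq_bigr => i _.
  rewrite Rintegral_sum// => [|j]; last exact: integrable_ip.
  rewrite (bigD1 i)//= big1 ?addr0 => [|j ji]; last by rewrite X_orth// eq_sym.
  by apply: eq_Rintegral => om _; rewrite (ip_norm ipP).
rewrite (_ : _ \o _ = fun om => \sum_j (ip (X i om) (X j om))%:E)%E.
  by apply: integrable_sum => // j _; exact: integrable_ip.
by apply/funext => om; rewrite /= sumEFin.
Qed.

End square_integrable.

Definition weak_expectation {R : realType} {d} {Omega : measurableType d}
    (P : probability Omega R) {V : normedModType R} (ip : V -> V -> R)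
    (X : Omega -> V) (m : V) : Prop :=
  forall v, ip m v = \int[P]_om ip (X om) v.

Section weak_expectation.
Context {R : realType} {d : measure_display} {Omega : measurableType d}
  {P : probability Omega R}.

Lemma weak_expectation_dual {V : completeNormedModType R} {ip : V -> V -> R}
    {X : Omega -> V} {m : V} {l : V -> R} :
  is_inner_product ip -> weak_expectation P ip X m -> is_dual l ->
  l m = \int[P]_om l (X om).
Proof.
move=> ipP X_m l_dual; have [r lr] := riesz_representation ipP l_dual.
by rewrite lr (ipC ipP) X_m; apply: eq_Rintegral => om _; rewrite lr (ipC ipP).
Qed.

Context {V : normedModType R} {ip : V -> V -> R}.
Hypotheses (sepV : separable_space V) (ipP : is_inner_product ip).

Lemma weak_expectation_center {X : Omega -> V} {m : V} :
  square_integrable P (fun om => X om - m) -> weak_expectation P ip X m ->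
  weak_expectation P ip (fun om => X om - m) 0.
Proof.
move=> Xm_sqr X_m v; rewrite (ip0l ipP); apply: (addIr (ip m v)).
have v_sqr := square_integrable_cst (P := P) v.
have m_v : ip m v = \int[P]_om ip m v.
  by rewrite Rintegral_cst// [X in fine X](probability_setT P) mulr1.
rewrite add0r [in RHS]m_v -RintegralD//.
- by rewrite [LHS]X_m; apply: eq_Rintegral => om _; rewrite -(ipDl ipP) subrK.
- exact: (integrable_ip sepV ipP Xm_sqr v_sqr).
- exact: finite_measure_integrable_cst.
Qed.

Lemma weak_expectation_same_law {d'} {T : measurableType d'}
    {X Y : {mfun Omega >-> T}} {Z : T -> V} {m : V} :
  same_law P X Y -> borel_measurable Z ->
  weak_expectation P ip (Z \o Y) m -> weak_expectation P ip (Z \o X) m.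
Proof.
move=> XY mZ ZY_m v; rewrite ZY_m /Rintegral; congr fine.
apply/esym/(integral_same_law XY (g := fun x => (ip (Z x) v)%:E)).
apply/measurable_EFinP; apply: (measurable_ip sepV ipP mZ).
exact: borel_measurable_cst.
Qed.

Lemma Rintegral_ip_independent_pair {d1 d2} {T1 : measurableType d1}
    {T2 : measurableType d2} {X : {mfun Omega >-> T1}} {Y : {mfun Omega >-> T2}}
    {Z1 : T1 -> V} {Z2 : T2 -> V} {m1 m2 : V} :
  independent_pair P X Y -> borel_measurable Z1 -> borel_measurable Z2 ->
  square_integrable P (Z1 \o X) -> square_integrable P (Z2 \o Y) ->
  weak_expectation P ip (Z1 \o X) m1 -> weak_expectation P ip (Z2 \o Y) m2 ->
  \int[P]_om ip (Z1 (X om)) (Z2 (Y om)) = ip m1 m2.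
Proof.
move=> XY mZ1 mZ2 X_sqr Y_sqr X_m1 Y_m2.
have mip1 v : measurable_fun setT (fun x => (ip (Z1 x) v)%:E).
  apply/measurable_EFinP; apply: (measurable_ip sepV ipP mZ1).
  exact: borel_measurable_cst.
have mip2 v : measurable_fun setT (fun y => (ip v (Z2 y))%:E).
  apply/measurable_EFinP; apply: (measurable_ip sepV ipP _ mZ2).
  exact: borel_measurable_cst.
have mip12 : measurable_fun setT (fun p => (ip (Z1 p.1) (Z2 p.2))%:E).
  apply/measurable_EFinP; apply: (measurable_ip sepV ipP).
    exact: (borel_measurable_comp mZ1 measurable_fst).
  exact: (borel_measurable_comp mZ2 measurable_snd).
have inner y :
    (\int[distribution P X]_x (ip (Z1 x) (Z2 y))%:E = (ip m1 (Z2 y))%:E)%E.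
  have iZ1y := integrable_ip sepV ipP X_sqr (square_integrable_cst (Z2 y)).
  rewrite integral_distribution// X_m1 /Rintegral fineK//.
  exact: (integrable_fin_num measurableT iZ1y).
rewrite /Rintegral (integral_independent_pair XY mip12); last first.
  exact: (integrable_ip sepV ipP X_sqr Y_sqr).
under eq_integral do rewrite inner.
rewrite integral_distribution//; last first.
  exact: (integrable_ip sepV ipP (square_integrable_cst m1) Y_sqr).
rewrite (ipC ipP) Y_m2; apply: eq_Rintegral => om _ /=.
by rewrite (ipC ipP).
Qed.

End weak_expectation.

Section sample_mean.
Context {R : realType} {d d' : measure_display} {Omega : measurableType d}
  {T : measurableType d'} {P : probability Omega R} {V : normedModType R}.

Definition sample_mean (N : nat) (Z : T -> V) (X : nat -> Omega -> T)
    (om : Omega) : V :=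
  N%:R^-1 *: \sum_(i < N) Z (X i om).

Lemma sample_mean_subr N (Z : T -> V) (m : V) X om : (0 < N)%N ->
  sample_mean N (fun x => Z x - m) X om = sample_mean N Z X om - m.
Proof.
move=> N0; rewrite /sample_mean sumrB scalerBr sumr_const card_ord.
by rewrite -(scaler_nat N m) scalerA mulVf ?scale1r// pnatr_eq0 -lt0n.
Qed.

Context {ip : V -> V -> R} {X : nat -> Omega -> T} {Y : Omega -> T} {Z : T -> V}
  {m : V} {N : nat}.
Hypotheses (ipP : is_inner_product ip) (sepV : separable_space V)
  (mX : forall i, measurable_fun setT (X i)) (mY : measurable_fun setT Y)
  (X_law : forall i, same_law P (X i) Y) (X_indep : mutually_independent P X)
  (mZ : borel_measurable Z)
  (Z_sqr : square_integrable P (fun om => Z (Y om) - m))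
  (Z_mean : weak_expectation P ip (Z \o Y) m) (N0 : (0 < N)%N).

Let D x := Z x - m.
Let mD : borel_measurable D := borel_measurable_subr m mZ.

Let Xm i : {mfun Omega >-> T} :=
  HB.pack (X i) (isMeasurableFun.Build _ _ _ _ _ (mX i)).
Let Ym : {mfun Omega >-> T} := HB.pack Y (isMeasurableFun.Build _ _ _ _ _ mY).
Let Xm_law i : same_law P (Xm i) Ym.
Proof. exact: X_law. Qed.

Let D_sqr i : square_integrable P (D \o X i).
Proof. exact: square_integrable_same_law (Xm_law i) mD Z_sqr. Qed.

Lemma square_integrable_sample_mean :
  square_integrable P (fun om => sample_mean N Z X om - m).
Proof.
under eq_fun do rewrite -sample_mean_subr//.
apply: square_integrableZ.
exact: (square_integrable_sum sepV ipP _ (fun i : 'I_N => D_sqr i)).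
Qed.

Lemma variance_sample_mean :
  \int[P]_om (`|sample_mean N Z X om - m| ^+ 2) =
  N%:R^-1 * \int[P]_om (`|Z (Y om) - m| ^+ 2).
Proof.
have D_mean i : weak_expectation P ip (D \o X i) 0.
  apply: weak_expectation_same_law (Xm_law i) mD _ => //.
  exact: weak_expectation_center.
have D_orth i j : i != j -> \int[P]_om ip (D (X i om)) (D (X j om)) = 0.
  move=> ij; rewrite -[RHS](ip0l ipP 0).
  exact: (Rintegral_ip_independent_pair (X := Xm i) (Y := Xm j) sepV ipP
    (mutually_independent_pair X_indep ij) mD mD
    (D_sqr i) (D_sqr j) (D_mean i) (D_mean j)).
have DE i : \int[P]_om (`|D (X i om)| ^+ 2) = \int[P]_om (`|Z (Y om) - m| ^+ 2).
  congr fine.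
  apply: (integral_same_law (Xm_law i) (g := fun x => (`|D x| ^+ 2)%:E)).
  exact/measurable_EFinP/measurable_norm_sqr.
transitivity (\int[P]_om (N%:R^-1 ^+ 2 * `|\sum_(i < N) D (X i om)| ^+ 2)).
  apply: eq_Rintegral => om _; rewrite -sample_mean_subr// normrZ exprMn.
  by rewrite ger0_norm// invr_ge0.
have [_ iS] := square_integrable_sum sepV ipP (index_enum _)
  (fun i : 'I_N => D_sqr i).
rewrite RintegralZl//.
rewrite (Rintegral_norm_sqr_sum_orthogonal sepV ipP
  (X := fun i : 'I_N => D \o X i))// => [|i j ij]; last exact: D_orth.
rewrite (eq_bigr _ (fun (i : 'I_N) _ => DE i)) sumr_const card_ord.
by rewrite -mulr_natl; field; rewrite pnatr_eq0 -lt0n.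
Qed.

End sample_mean.

Lemma convex_ge_differential {R : realType} {V : normedModType R} {g : V -> R}
    {u v : V} :
  (forall t, 0 <= t <= 1 ->
     g (t *: v + (1 - t) *: u) <= t * g v + (1 - t) * g u) ->
  differentiable g u -> 'd g u (v - u) <= g v - g u.
Proof.
move=> g_convex g_diff; rewrite -deriveE//.
have /(diff_derivable (v := v - u)) g_der := g_diff.
apply: cvgr_to_le (cvg_dnbhs_at_right g_der) _; near=> t.
have t0 : 0 < t by near: t; exact: nbhs_right_gt.
have t1 : t <= 1 by near: t; exact: nbhs_right_le.
rewrite /= /GRing.scale/= mulrC ler_pdivrMr//.
have -> : t *: (v - u) + u = t *: v + (1 - t) *: u.
  by rewrite scalerBr scalerBl scale1r addrAC -addrA.
have := g_convex t; rewrite (ltW t0) t1 => /(_ isT); lra.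
Unshelve. all: by end_near. Qed.

Lemma minimizer_lty {T : Type} {R : realType} {g : T -> R} {psi : T -> \bar R}
    {u : T} :
  (exists v, psi v < +oo)%E ->
  (forall v, (g u)%:E + psi u <= (g v)%:E + psi v)%E -> (psi u < +oo)%E.
Proof.
move=> [v psi_v] u_min.
have : ((g u)%:E + psi u < +oo)%E.
  by apply: le_lt_trans (u_min v) _; rewrite lte_add_pinfty// ltry.
by rewrite !ltey; apply: contra_neq => ->; rewrite addey.
Qed.

(* [a] stands for the derivative at [v] of the expected objective in the
   direction [u - v], and [b] for that of the sampled objective [g]. *)
Lemma growth_le_derivative_gap {T : Type} {R : realType} {g : T -> R}
    {psi : T -> \bar R} {u v : T} {r a b : R} :
  (forall w, 0 <= psi w)%E -> (psi u < +oo)%E -> (psi v < +oo)%E ->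
  (r%:E <= a%:E + psi u - psi v)%E -> b <= g u - g v ->
  ((g u)%:E + psi u <= (g v)%:E + psi v)%E -> r <= a - b.
Proof.
move=> psi_ge0; rewrite -!ge0_fin_numE// => /fineK <- /fineK <-.
rewrite !lee_fin; lra.
Qed.

Lemma powR_growth_sqr {R : realType} {theta r rho q : R} :
  0 < theta -> 1 < rho -> 0 <= r -> theta * r `^ rho <= q * r ->
  theta ^+ 2 * r `^ (2 * (rho - 1)) <= q ^+ 2.
Proof.
move=> theta0 rho1; rewrite le_eqVlt => /predU1P[<- _|r0].
  by rewrite powR0 ?mulr0 ?sqr_ge0// gt_eqF// mulr_gt0// subr_gt0.
have -> : r `^ rho = r `^ (rho - 1) * r.
  have nz : (rho - 1 + 1 == 0) ==> (r != 0) by rewrite (gt_eqF r0) implybT.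
  by rewrite -{1}(subrK 1 rho) (powRD nz) powRr1// ltW.
rewrite mulrA ler_pM2r// => r_le.
rewrite mulrC [2 * _]mulrC powRrM powR_mulrn ?powR_ge0// -exprMn mulrC.
by rewrite ler_pXn2r// nnegrE ?(le_trans _ r_le)// mulr_ge0 ?powR_ge0// ltW.
Qed.

Lemma integral_powR_growth_sqr {R : realType} {d} {T : measurableType d}
    {mu : {measure set T -> \bar R}} {theta rho C : R} {r q : T -> R} :
  0 < theta -> 1 < rho -> (forall x, 0 <= r x) -> measurable_fun setT r ->
  mu.-integrable setT (EFin \o (fun x => q x ^+ 2)) ->
  (forall x, theta * r x `^ rho <= C * r x * q x) ->
  ((theta ^+ 2)%:E * \int[mu]_x (r x `^ (2 * (rho - 1)))%:E <=
   (C ^+ 2 * \int[mu]_x (q x ^+ 2))%:E)%E.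
Proof.
move=> theta0 rho1 r0 mr iq growth.
have mpow : measurable_fun setT (fun x => (r x `^ (2 * (rho - 1)))%:E).
  exact/measurable_EFinP/(measurableT_comp (measurable_powR _)).
rewrite (EFinM (C ^+ 2)) fineK; last exact: (integrable_fin_num measurableT iq).
rewrite -ge0_integralZl_EFin ?sqr_ge0// => [|x _]; last first.
  by rewrite lee_fin powR_ge0.
rewrite -integralZl//; apply: ge0_le_integral => //.
- by move=> x _; rewrite -EFinM lee_fin mulr_ge0 ?sqr_ge0 ?powR_ge0.
- exact: measurable_funeM.
- exact: measurable_int (integrableZl measurableT _ iq).
- move=> x _; rewrite -!EFinM lee_fin -exprMn.
  by apply: powR_growth_sqr => //; rewrite mulrAC.
Qed.

Lemma convex_comp_linear {R : realType} {V W : normedModType R}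
    (B : {linear V -> W}) {A : set V} {f : W -> R} {u v : V} {t : R} :
  (forall w1 w2 s, (B @` A) w1 -> (B @` A) w2 -> 0 <= s <= 1 ->
     f (s *: w1 + (1 - s) *: w2) <= s * f w1 + (1 - s) * f w2) ->
  A u -> A v -> 0 <= t <= 1 ->
  f (B (t *: u + (1 - t) *: v)) <= t * f (B u) + (1 - t) * f (B v).
Proof.
by move=> f_convex Au Av t01; rewrite linearD !linearZ/=; exact: f_convex.
Qed.

Lemma FhatN_ge_differential {R : realType} {d d'} {Omega : measurableType d}
    {Xi : measurableType d'} {V : normedModType R} {xis : nat -> Omega -> Xi}
    {g : V -> Xi -> R} {u v : V} (N : nat) (om : Omega) :
  (forall x, differentiable (g^~ x) u) ->
  (forall x t, 0 <= t <= 1 ->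
     g (t *: v + (1 - t) *: u) x <= t * g v x + (1 - t) * g u x) ->
  FhatN xis (fun h x => 'd (g^~ x) u h) N (v - u) om <=
  FhatN xis g N v om - FhatN xis g N u om.
Proof.
move=> g_diff g_convex; rewrite /FhatN -mulrBr -sumrB ler_wpM2l ?invr_ge0//.
apply: ler_sum => i _; apply: convex_ge_differential => // t.
exact: g_convex.
Qed.

Lemma ip_adjoint_DFexp {R : realType} {d d'} {Omega : measurableType d}
    {Xi : measurableType d'} {P : probability Omega R} {U W : normedModType R}
    {H : completeNormedModType R} {ipU : U -> U -> R} {ipH : H -> H -> R}
    {B : U -> W} {Bstar : (W -> R) -> U} {xi : Omega -> Xi}
    {Df : W -> Xi -> W -> R} {zeta : Xi -> R} {w : W} {l : H -> R}
    {gradH : Xi -> H} {m : H} {h : U} :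
  (forall phi, is_dual phi -> forall u, ipU (Bstar phi) u = phi (B u)) ->
  measurable_fun setT xi -> (forall x, is_dual (Df w x)) ->
  dual_measurable (Df w) -> (forall x, dual_norm (Df w x) <= zeta x) ->
  P.-integrable setT (EFin \o (zeta \o xi)) ->
  is_inner_product ipH -> weak_expectation P ipH (gradH \o xi) m -> is_dual l ->
  (forall x, ipU (Bstar (Df w x)) h = l (gradH x)) ->
  ipU (Bstar (DFexp P xi Df w)) h = l m.
Proof.
move=> adjB mxi Df_dual mDf Df_le izeta ipHP gradH_mean l_dual gradE.
rewrite adjB; last exact: is_dual_DFexp mxi Df_dual mDf Df_le izeta.
rewrite [RHS](weak_expectation_dual ipHP gradH_mean l_dual).
by apply: eq_Rintegral => om _; rewrite -gradE adjB.
Qed.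

Lemma scalar_sample_mean {R : realType} {d d'} {Omega : measurableType d}
    {T : measurableType d'} {V : normedModType R} (l : {scalar V}) N
    (Z : T -> V) (X : nat -> Omega -> T) om :
  l (sample_mean N Z X om) = N%:R^-1 * \sum_(i < N) l (Z (X i om)).
Proof. by rewrite /sample_mean scalarZ linear_sum. Qed.

(* First-order optimality at [v] is perturbed only through the error of the
   sample mean of the gradients, represented in [H] by the pairing [ell]. *)
Lemma growth_le_sampling_error {R : realType} {d d'} {Omega : measurableType d}
    {Xi : measurableType d'} {V H : normedModType R} {xis : nat -> Omega -> Xi}
    {g : V -> Xi -> R} {psi : V -> \bar R} {u v : V} {ell : V -> H -> R}
    {gradH : Xi -> H} {m : H} {N : nat} {om : Omega} {r C : R} :
  (forall w, 0 <= psi w)%E -> (psi u < +oo)%E -> (psi v < +oo)%E ->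
  scalar (ell (u - v)) -> (forall z, `|ell (u - v) z| <= C * `|z|) ->
  (forall x, differentiable (g^~ x) v) ->
  (forall x h, 'd (g^~ x) v h = ell h (gradH x)) ->
  (forall x t, 0 <= t <= 1 ->
     g (t *: u + (1 - t) *: v) x <= t * g u x + (1 - t) * g v x) ->
  ((FhatN xis g N u om)%:E + psi u <= (FhatN xis g N v om)%:E + psi v)%E ->
  (r%:E <= (ell (u - v) m)%:E + psi u - psi v)%E ->
  r <= C * `|sample_mean N gradH xis om - m|.
Proof.
move=> psi_ge0 psi_u psi_v ell_scalar ell_le g_diff gradE g_convex u_min growth.
pose l := pack_scalar ell_scalar.
have g_ge : l (sample_mean N gradH xis om) <=
    FhatN xis g N u om - FhatN xis g N v om.
  rewrite scalar_sample_mean.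
  apply: le_trans (FhatN_ge_differential N om g_diff g_convex).
  by rewrite /FhatN; under [in leRHS]eq_bigr do rewrite gradE.
apply: le_trans (growth_le_derivative_gap (g := fun w => FhatN xis g N w om)
  psi_ge0 psi_u psi_v growth g_ge u_min) _.
rewrite -[ell _ m]/(l m) -linearB distrC.
exact: le_trans (ler_norm _) (ell_le _).
Qed.

Section embedding_pairing.
Context {R : realType} {U UU H : normedModType R} {ipU : U -> U -> R}
  {jU : U -> UU} {kU : (UU -> R) -> U} {eH : H -> UU -> R} {C_H : R}.
Hypotheses (ipUP : is_inner_product ipU)
  (kU_lin : forall a phi phi', is_dual phi -> is_dual phi' ->
     kU (fun v => a * phi v + phi' v) = a *: kU phi + kU phi')
  (kU_le : forall phi, is_dual phi ->
     forall u, `|ipU (kU phi) u| <= dual_norm phi * `|jU u|)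
  (eH_dual : forall z, is_dual (eH z))
  (eH_lin : forall a z z', eH (a *: z + z') = (fun v => a * eH z v + eH z' v))
  (eH_le : forall z, dual_norm (eH z) <= C_H * `|z|).

Lemma embedding_pairing_le z u :
  `|ipU (kU (eH z)) u| <= C_H * `|jU u| * `|z|.
Proof.
by apply: le_trans (kU_le _ (eH_dual z) u) _; rewrite mulrAC ler_wpM2r.
Qed.

Lemma is_dual_embedding_pairing u : is_dual (fun z => ipU (kU (eH z)) u).
Proof.
apply: (bounded_is_dual (C_H * `|jU u|)) => [a z z'|z].
  by rewrite eH_lin kU_lin// (ip_scalar ipUP).
exact: embedding_pairing_le.
Qed.

End embedding_pairing.

Lemma sample_mean_growth_bound {R : realType} {d d'} {Omega : measurableType d}
    {T : measurableType d'} {P : probability Omega R} {V : normedModType R}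
    {ip : V -> V -> R} {X : nat -> Omega -> T} {Y : Omega -> T} {Z : T -> V}
    {m : V} {N : nat} {theta rho C : R} {r : Omega -> R} :
  is_inner_product ip -> separable_space V ->
  (forall i, measurable_fun setT (X i)) -> measurable_fun setT Y ->
  (forall i, same_law P (X i) Y) -> mutually_independent P X ->
  borel_measurable Z -> square_integrable P (fun om => Z (Y om) - m) ->
  weak_expectation P ip (Z \o Y) m -> (0 < N)%N ->
  0 < theta -> 1 < rho -> (forall om, 0 <= r om) -> measurable_fun setT r ->
  (forall om, theta * r om `^ rho <= C * r om * `|sample_mean N Z X om - m|) ->
  ((theta ^+ 2)%:E * \int[P]_om (r om `^ (2 * (rho - 1)))%:E <=
   (N%:R^-1 * C ^+ 2 * \int[P]_om (`|Z (Y om) - m| ^+ 2))%:E)%E.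
Proof.
move=> ipP sepV mX mY X_law X_indep mZ Z_sqr Z_mean N0 theta0 rho1 r0 mr growth.
have [_ iM] := square_integrable_sample_mean ipP sepV mX mY X_law mZ Z_sqr N0.
rewrite (mulrC N%:R^-1) -mulrA.
rewrite -(variance_sample_mean ipP sepV mX mY X_law X_indep mZ Z_sqr Z_mean N0).
exact: integral_powR_growth_sqr theta0 rho1 r0 mr iM growth.
Qed.

Theorem theorem3p11
  (R : realType)
  (* the Hilbert space U (identified with its dual via ipU) *)
  (U : completeNormedModType R) (ipU : U -> U -> R)
  (* the Banach space W; elements of W^* are represented as functions W -> R *)
  (W : completeNormedModType R)
  (B : {linear U -> W}) (Bstar : (W -> R) -> U)
  (psi : U -> \bar R) (U0 : set U)
  (dXi : measure_display) (Xi : measurableType dXi)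
  (dO : measure_display) (Omega : measurableType dO) (P : probability Omega R)
  (xi : Omega -> Xi) (xis : nat -> Omega -> Xi)
  (f : W -> Xi -> R) (zeta_f : Xi -> R)
  (grad : Xi -> U -> U) (Df : W -> Xi -> W -> R) (zeta_Df : Xi -> R)
  (ustar : U) (uN : nat -> Omega -> U)
  (* the Banach space UU (= script U) with U^* embedded in U and U embedded in UU *)
  (UU : completeNormedModType R) (jU : {linear U -> UU}) (kU : (UU -> R) -> U)
  (* the Hilbert space H embedded in UU^* *)
  (H : completeNormedModType R) (ipH : H -> H -> R) (eH : H -> (UU -> R))
  (C_H : R) (theta rho : R) (gradH : Xi -> H) (meanH : H) :
  let domPsi := [set u | (psi u < +oo)%E] in
  let BdomPsi := B @` domPsi in
  let BU0 := B @` U0 in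
  (* U : separable Hilbert space; W : separable Banach space *)
  is_inner_product ipU -> separable_space U ->
  separable_space W ->
  (* B compact linear operator, Bstar its adjoint *)
  continuous B ->
  compact (closure (B @` [set u : U | `|u| <= 1])) ->
  (forall phi, is_dual phi -> forall u, ipU (Bstar phi) u = phi (B u)) ->
  (* psi : U -> [0, oo] proper, closed (lsc), convex, with bounded domain *)
  (forall u, (0 <= psi u)%E) ->
  (exists u, (psi u < +oo)%E) ->
  (forall c : R, closed [set u | (psi u <= c%:E)%E]) ->
  (forall (u v : U) (t : R), 0 < t < 1 ->
     (psi (t *: u + (1 - t) *: v)%R <= t%:E * psi u + (1 - t)%R%:E * psi v)%E) ->
  bounded_set domPsi ->
  (* U0 open, convex, bounded, containing dom psi *)
  open U0 -> convex_set U0 -> bounded_set U0 -> domPsi `<=` U0 ->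
  (* Xi complete separable metric space (with its Borel sets),
     complete probability space, xi and i.i.d. copies xis *)
  polish_borel R Xi ->
  measure_is_complete P ->
  measurable_fun setT xi ->
  (forall i, measurable_fun setT (xis i)) ->
  (forall i (A : set Xi), measurable A -> P (xis i @^-1` A) = P (xi @^-1` A)) ->
  mutually_independent P xis ->
  (* assumptions on f *)
  (forall x, {within BdomPsi, continuous (fun w => f w x)}) ->
  (forall w, BU0 w -> measurable_fun setT (f w)) ->
  measurable_fun setT zeta_f ->
  P.-integrable setT (fun om => (zeta_f (xi om))%:E) ->
  (forall u x, U0 u -> `|f (B u) x| <= zeta_f x) ->
  (* g_xi(u) = f(Bu, xi) is continuously differentiable on U0, gradient grad *)
  (forall x u, U0 u ->
     differentiable (fun v => f (B v) x) u /\
     forall h, 'd (fun v => f (B v) x) u h = ipU (grad x u) h) ->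
  (forall x u, U0 u -> {for u, continuous (grad x)}) ->
  (* D_w f : B(dom psi) x Xi -> W^* is a Caratheodory map *)
  (forall w x, BdomPsi w -> is_dual (Df w x)) ->
  (forall x w, BdomPsi w -> forall e : R, 0 < e -> exists2 d : R, 0 < d &
     forall w', BdomPsi w' -> `|w' - w| < d ->
       dual_norm (fun v => Df w' x v - Df w x v) < e) ->
  (forall w, BdomPsi w -> dual_measurable (Df w)) ->
  (forall x u, domPsi u -> grad x u = Bstar (Df (B u) x)) ->
  measurable_fun setT zeta_Df ->
  P.-integrable setT (fun om => (zeta_Df (xi om))%:E) ->
  (forall x u, U0 u -> `|grad x u| <= zeta_Df x) ->
  (forall x u, domPsi u -> dual_norm (Df (B u) x) <= zeta_Df x) ->
  (* u* solves min_u F(Bu) + psi(u) *)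
  (forall u, ((Fexp P xi f (B ustar))%:E + psi ustar <=
              (Fexp P xi f (B u))%:E + psi u)%E) ->
  (* u_N^* measurable, solves the SAA problem pointwise *)
  (forall N, (0 < N)%N -> borel_measurable (uN N)) ->
  (forall N, (0 < N)%N -> forall om u,
     ((FhatN xis f N (B (uN N om)) om)%:E + psi (uN N om) <=
      (FhatN xis f N (B u) om)%:E + psi u)%E) ->
  (* UU^* embedded in U, U embedded in UU *)
  injective jU -> continuous jU ->
  (forall (a : R) (phi phi' : UU -> R), is_dual phi -> is_dual phi' ->
     kU (fun v => a * phi v + phi' v) = a *: kU phi + kU phi') ->
  (forall phi phi' : UU -> R, is_dual phi -> is_dual phi' ->
     kU phi = kU phi' -> phi = phi') ->
  (exists c : R, forall phi : UU -> R, is_dual phi ->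
     `|kU phi| <= c * dual_norm phi) ->
  (forall phi : UU -> R, is_dual phi -> forall u : U,
     `|ipU (kU phi) u| <= dual_norm phi * `|jU u|) ->
  (* H separable Hilbert space embedded in UU^* with constant C_H *)
  is_inner_product ipH -> separable_space H ->
  (forall h, is_dual (eH h)) ->
  (forall (a : R) (h h' : H), eH (a *: h + h') = (fun v => a * eH h v + eH h' v)) ->
  injective eH ->
  (forall h, dual_norm (eH h) <= C_H * `|h|) ->
  (* growth condition *)
  0 < theta -> 2 <= rho ->
  (forall u, ((ipU (Bstar (DFexp P xi Df (B ustar))) (u - ustar)%R)%:E
               + psi u - psi ustar >= (theta * `|jU (u - ustar)| `^ rho)%R%:E)%E) ->
  (* xi |-> grad g_xi at ustar is an integrable H-valued map, with mean meanH
     and finite variance sigma_Df^2 *)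
  (forall x, kU (eH (gradH x)) = grad x ustar) ->
  borel_measurable gradH ->
  P.-integrable setT (fun om => (`|gradH (xi om)|)%:E) ->
  (forall h, ipH meanH h = fine (\int[P]_om (ipH (gradH (xi om)) h)%:E)%E) ->
  (\int[P]_om (`|gradH (xi om) - meanH| ^+ 2)%R%:E < +oo)%E ->
  (* f(., xi) convex *)
  (forall x (w1 w2 : W) (t : R), BU0 w1 -> BU0 w2 -> 0 <= t <= 1 ->
     f (t *: w1 + (1 - t) *: w2) x <= t * f w1 x + (1 - t) * f w2 x) ->
  (* conclusion *)
  forall N : nat, (0 < N)%N ->
    ((theta ^+ 2)%R%:E *
       \int[P]_om (`|jU (uN N om - ustar)| `^ (2 * (rho - 1)))%R%:E
     <= (N%:R^-1 * C_H ^+ 2 *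
         fine (\int[P]_om (`|gradH (xi om) - meanH| ^+ 2)%R%:E))%R%:E)%E.
Proof.
move=> domPsi BdomPsi BU0 ipUP _ _ _ _ adjB psi_ge0 dom_psi _ _ _ _ _ _ domU0.
move=> _ _ mxi mxis law indep _ _ _ _ _ f_diff _ Df_dual _ mDf gradE _ izeta _.
move=> Df_le ustar_min muN uN_min _ jU_cont kU_lin _ _ kU_le ipHP sepH eH_dual.
move=> eH_lin _ eH_le theta0 rho2 growth gradHE mgradH _ gradH_mean gradH_var.
move=> f_convex N N0.
have dom_ustar : domPsi ustar := minimizer_lty dom_psi ustar_min.
have dom_uN om : domPsi (uN N om) := minimizer_lty dom_psi (uN_min N N0 om).
have BdomPsi_ustar : BdomPsi (B ustar) by exists ustar.
pose ell h z := ipU (kU (eH z)) h.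
have ell_dual h : is_dual (ell h) :=
  is_dual_embedding_pairing ipUP kU_lin kU_le eH_dual eH_lin eH_le h.
have ell_mean h : ipU (Bstar (DFexp P xi Df (B ustar))) h = ell h meanH.
  apply: (ip_adjoint_DFexp adjB mxi (Df_dual _ ^~ BdomPsi_ustar)
    (mDf _ BdomPsi_ustar) (fun x => Df_le x _ dom_ustar) izeta ipHP gradH_mean)
    => // x; by rewrite -gradE// -gradHE.
apply: (sample_mean_growth_bound ipHP sepH mxis mxi law indep mgradH _
  gradH_mean N0 theta0 _ (fun=> normr_ge0 _)) => [|||om].
- apply: square_integrable_lty gradH_var.
  exact/borel_measurable_subr/(borel_measurable_comp mgradH mxi).
- by apply: lt_le_trans rho2; rewrite ltr1n.
- exact: measurable_norm_comp_subr jU_cont (muN N N0).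
- apply: (growth_le_sampling_error psi_ge0 (dom_uN om) dom_ustar (ell_dual _).1
    _ _ _ _ (uN_min N N0 om ustar)) => [z|x|x h|x t|].
  + exact: embedding_pairing_le kU_le eH_dual eH_le z _.
  + exact: (f_diff x _ (domU0 _ dom_ustar)).1.
  + by rewrite (f_diff _ _ (domU0 _ dom_ustar)).2 -gradHE.
  + by apply: (convex_comp_linear B (f_convex x)); exact: domU0.
  + by rewrite -ell_mean; exact: growth.
Qed.
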